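(* Let $G$ be a non-feebly compact precompact $T_1$ paratopological group with a countable dense subgroup $P$. Then there exists a subset $L$ of $P$ such that $L$ is discrete and closed in $G$ and $\langle L\rangle=P$. In particular, $L$ is a suitable set for $G$, and thus $G$ has a closed suitable set.
   Context: A paratopological group is a group $G$ endowed with a topology such that the group operation $G\times G\to G$ is continuous (inversion need not be continuous). The identity is denoted by $e$, and $\langle S\rangle$ denotes the subgroup generated by $S$. A subset $S$ of a paratopological group $G$ is a suitable set for $G$ if $S$ is a discrete subspace of $G$, $S\cup\{e\}$ is closed in $G$, and $\langle S\rangle$ is dense in $G$. A closed suitable set is a suitable set that is closed in $G$. A space is feebly compact if each locally finite family of non-empty open subsets of the space is finite. A paratopological group $G$ is precompact if for each neighborhood $U$ of the identity of $G$ there exists a finite subset $F$ of $G$ such that $FU=G$. *)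

(* Defs.v *)
From HB Require Import structures.
From mathcomp Require Import all_boot all_classical topology.

Set Implicit Arguments.
Unset Strict Implicit.
Unset Printing Implicit Defensive.

Local Open Scope classical_set_scope.
Local Open Scope group_scope.

HB.structure Definition PreTopologicalGroup := {G of Topological G & Group G}.

HB.mixin Record PreTopologicalGroup_isParatopological G
    & PreTopologicalGroup G := {
  mulg_continuous : continuous (fun x : G * G => x.1 * x.2)
}.

(* Inversion is not assumed to be continuous. *)
#[short(type="paratopologicalGroupType")]
HB.structure Definition ParatopologicalGroup :=
  {G of PreTopologicalGroup G & PreTopologicalGroup_isParatopological G}.

Definition is_subgroup (G : groupType) (H : set G) : Prop :=
  group_closed [in H].

Definition generated_subgroup (G : groupType) (S : set G) : set G :=
  smallest (@is_subgroup G) S.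

(* [set_type S] carries the topology induced by that of [T]. *)
Definition discrete_subspace (T : topologicalType) (S : set T) : Prop :=
  forall U : set (set_type S), open U.

Definition locally_finite (T : topologicalType) (F : set_system T) : Prop :=
  forall x : T, exists2 U, nbhs x U & finite_set [set V | F V /\ V `&` U !=set0].

(* A locally finite indexed family of nonempty sets repeats each of its members
   only finitely often, so collections of sets suffice here. *)
Definition feebly_compact (T : topologicalType) : Prop :=
  forall F : set_system T, (forall V, F V -> open V /\ V !=set0) ->
    locally_finite F -> finite_set F.

(* Unrelated to [precompact] of the topology library, which says that a set has
   compact closure. *)
Definition precompact_group (G : paratopologicalGroupType) : Prop :=
  forall U : set G, nbhs 1 U ->
    exists2 F : set G, finite_set F & [set x * y | x in F & y in U] = [set: G].

Definition suitable_set (G : paratopologicalGroupType) (S : set G) : Prop :=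
  [/\ discrete_subspace S, closed (S `|` [set 1]) & dense (generated_subgroup S)].

Definition closed_suitable_set (G : paratopologicalGroupType) (S : set G) : Prop :=
  suitable_set S /\ closed S.

(* Main.v *)
(** By precompactness every nonempty open set [U] satisfies [P = Q (U `&` P)] for
    some finite [Q `<=` P].  Apply this to an infinite locally finite sequence of
    nonempty open sets [U_n]: collect [Q_0] and, for each [n], finitely many
    elements of [U_n `&` P] that generate, together with [Q_n], the next finite
    set [Q_n.+1] and the [n]-th element of [P].  The resulting set generates [P]
    by induction, and it is closed and discrete because all but finitely many of
    its elements were picked one finite batch in each [U_n]. *)
Require Import Defs.
From mathcomp Require Import all_boot all_classical topology.

Set Implicit Arguments.
Unset Strict Implicit.
Unset Printing Implicit Defensive.

Local Open Scope classical_set_scope.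

Section locally_finite_points.
Variable T : topologicalType.
Hypothesis T1 : accessible_space T.

(** Finite sets are closed in a [T1] space, so a neighborhood of a point outside [L] remains one
    after its finitely many points of [L] are removed. *)
Lemma locally_finite_closed (L : set T) :
  (forall x : T, exists2 U, nbhs x U & finite_set (U `&` L)) -> closed L.
Proof.
move=> Lfin x clLx; apply: contrapT => nLx.
have [U Ux ULfin] := Lfin x.
have cUL : closed (U `&` L) by exact: accessible_finite_set_closed.1.
have nUL : nbhs x (~` (U `&` L)).
  by apply: open_nbhs_nbhs; split; [exact: closed_openC|move=> -[]].
have [y [Ly [Uy nULy]]] := clLx _ (filterI Ux nUL).
exact: nULy.
Qed.

(** The hypothesis passes to subsets, so every subset of [L] is closed in [T]; hence every subset of
    the subspace [L] is the trace of an open set. *)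
Lemma locally_finite_discrete (L : set T) :
  (forall x : T, exists2 U, nbhs x U & finite_set (U `&` L)) ->
  discrete_subspace L.
Proof.
move=> Lfin U; set A := set_val @` (~` U).
have AL : A `<=` L by move=> _ [y _ <-]; exact: set_valP.
have cA : closed A.
  apply: locally_finite_closed => x; have [V Vx VL] := Lfin x.
  by exists V => //; apply: sub_finite_set VL; exact: setIS.
exists (~` A); first exact: closed_openC.
apply/seteqP; split => y /=.
  by move=> nAy; apply: contrapT => nUy; apply: nAy; exists y.
by move=> Uy [z nUz /val_inj zy]; apply: nUz; rewrite zy.
Qed.

End locally_finite_points.

Lemma dense_nbhs (T : topologicalType) (P U : set T) (x : T) :
  dense P -> nbhs x U -> exists2 y, P y & U y.
Proof.
move=> P_dense Ux; have [||y [Uy Py]] := P_dense U°.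
- by exists x.
- exact: open_interior.
- by exists y => //; exact: interior_subset.
Qed.

Section subgroups.
Local Open Scope group_scope.
Variables (G : groupType) (H : set G).
Hypothesis H_subgroup : is_subgroup H.

Lemma subgroupV x : H x -> H x^-1.
Proof.
by move=> /mem_set Hx; apply: set_mem; exact: (group_closedV H_subgroup).
Qed.

Lemma subgroupM x y : H x -> H y -> H (x * y).
Proof.
move=> /mem_set Hx /mem_set Hy; apply: set_mem.
exact: (group_closedM H_subgroup).
Qed.

End subgroups.

Lemma generated_subgroup_is_subgroup (G : groupType) (S : set G) :
  is_subgroup (generated_subgroup S).
Proof.
split; first by apply/mem_set => H [H_subgroup _]; apply: set_mem; case: H_subgroup.
move=> x y /set_mem Sx /set_mem Sy; apply/mem_set => H HS.
by apply: (subgroupM HS.1 (Sx H HS)); exact: (subgroupV HS.1 (Sy H HS)).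
Qed.

Section paratopological.
Local Open Scope group_scope.
Variable G : paratopologicalGroupType.

Lemma nbhs_mulg (x y : G) (U : set G) : nbhs (x * y) U ->
  exists A B, [/\ nbhs x A, nbhs y B & forall a b, A a -> B b -> U (a * b)].
Proof.
move=> Uxy; have [[A B] [/= xA yB] AB] := @mulg_continuous G (x, y) U Uxy.
by exists A, B; split => // a b Aa Bb; exact: (AB (a, b)).
Qed.

Lemma nbhs_mulgr (x y : G) (U : set G) :
  nbhs (x * y) U -> nbhs x [set z | U (z * y)].
Proof.
move=> /nbhs_mulg[A [B [xA yB AB]]]; apply: filterS xA => z Az.
exact: AB Az (nbhs_singleton yB).
Qed.

Lemma nbhs_mulgl (x y : G) (U : set G) :
  nbhs (x * y) U -> nbhs y [set z | U (x * z)].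
Proof.
move=> /nbhs_mulg[A [B [xA yB AB]]]; apply: filterS yB => z Bz.
exact: AB (nbhs_singleton xA) Bz.
Qed.

(** Each [h p] is a left translate of [p] by an element of [P]. Precompactness lets finitely many
    translating elements suffice, and [Q] consists of their inverses. *)
Lemma precompact_dense_subgroup (P U : set G) :
  precompact_group G -> is_subgroup P -> dense P -> open U -> U !=set0 ->
  exists Q : set G, exists h : G -> G,
    [/\ finite_set Q, Q `<=` P &
        forall p, P p -> [/\ P (h p), U (h p) & Q (p / h p)]].
Proof.
move=> G_precompact P_subgroup P_dense U_open U_neq0.
have [x [Ux Px]] := P_dense _ U_neq0 U_open.
have [A [B [A1 B1 AB]]] : exists A B, [/\ nbhs (1 : G) A, nbhs (1 : G) B &
    forall a b, A a -> B b -> U (x * (a * b))].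
  apply: (@nbhs_mulg 1 1 [set z | U (x * z)]); rewrite mulg1.
  by apply: nbhs_mulgl; rewrite mulg1; exact: open_nbhs_nbhs.
have [F F_finite FB] := G_precompact B B1.
(* Right translations are homeomorphisms, so the open set [A f^-1] meets [P]
   even though inversion need not be continuous. *)
have /choice[g gP] (f : G) : exists y, P y /\ A (y * f).
  have [|y Py Ayf] := @dense_nbhs _ P [set y | A (y * f)] f^-1 P_dense.
    by apply: nbhs_mulgr; rewrite mulVg.
  by exists y.
have /choice[h hP] (p : G) : exists u, P p ->
    [/\ P u, U u & [set (x * g f)^-1 | f in F] (p / u)].
  have : [set: G] p by [].
  (* With [p = f * b], the witness equals [(x * g f) * p], hence lies in [P]. Grouped as written, it
     lies in [U], because [g f * f] is in [A] and [b] in [B]. *)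
  rewrite -FB => -[f Ff [b Bb <-]]; exists (x * (g f * f * b)) => Pp.
  have [Pg Ag] := gP f.
  have eq_u : x * (g f * f * b) = x * g f * (f * b) by rewrite !mulgA.
  split; [| exact: AB |].
  - by rewrite eq_u; do !apply: subgroupM => //.
  - exists f => //.
    by rewrite eq_u [in RHS]invgM mulVKg.
exists [set (x * g f)^-1 | f in F], h; split => //.
- exact: finite_image.
- move=> _ [f Ff <-]; apply: subgroupV => //; apply: subgroupM => //.
  by have [] := gP f.
Qed.

Lemma locally_finite_generators (P : set G) (U : nat -> set G) :
  precompact_group G -> is_subgroup P -> countable P -> dense P ->
  (forall n, open (U n) /\ U n !=set0) ->
  (forall x : G, exists2 V, nbhs x V & finite_set [set n | V `&` U n !=set0]) ->
  exists L : set G, [/\ L `<=` P, generated_subgroup L = P &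
    forall x : G, exists2 V, nbhs x V & finite_set (V `&` L)].
Proof.
move=> G_precompact P_subgroup /countable_injP[rk rk_inj] P_dense U_open U_lf.
have /choice[Q /choice[h Qh]] n :=
  precompact_dense_subgroup G_precompact P_subgroup P_dense
    (U_open n).1 (U_open n).2.
(* These are the elements that stage [n] must generate. As [rk] is injective on [P], at most one of
   them comes from the enumeration. *)
pose R n := Q n.+1 `|` (P `&` rk @^-1` [set n]).
have R_finite n : finite_set (R n).
  rewrite finite_setU; split; first by have [] := Qh n.+1.
  have [->//|/set0P[p [Pp rkp]]] := eqVneq (P `&` rk @^-1` [set n]) set0.
  apply: sub_finite_set (finite_set1 p) => q [Pq rkq].
  by apply: rk_inj; rewrite ?inE// rkq rkp.
have RP n : R n `<=` P.
  by move=> p [|[]] //; have [_ + _] := Qh n.+1; apply.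
pose E n := h n @` R n.
pose L := Q 0%N `|` \bigcup_n E n.
have LP : L `<=` P.
  move=> y [|[n _ [p Rp <-]]]; first by have [_ + _] := Qh 0%N; apply.
  by have [_ _ /(_ p (RP _ _ Rp))[]] := Qh n.
have EU n : E n `<=` U n.
  by move=> _ [p Rp <-]; have [_ _ /(_ p (RP _ _ Rp))[]] := Qh n.
exists L; split => //.
- apply/seteqP; split; first exact: smallest_sub.
  have L_subgroup := generated_subgroup_is_subgroup L.
  have LL : L `<=` generated_subgroup L by exact: sub_gen_smallest.
  (* Factor [p] as [(p / h n p) * h n p], with the first factor in [Q n] and the second in [E n].
     Since [R n] contains [Q n.+1], this is the induction step for [QL]. *)
  have QR n : Q n `<=` generated_subgroup L -> R n `<=` generated_subgroup L.
    move=> QL p Rp; have [_ _ /(_ p (RP _ _ Rp))[_ _ /QL qL]] := Qh n.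
    rewrite -(mulgVK (h n p) p); apply: (subgroupM L_subgroup qL); apply: LL.
    by right; exists n => //; exists p.
  have QL : forall n, Q n `<=` generated_subgroup L.
    elim=> [|n /QR IHn] p Qp; first by apply: LL; left.
    by apply: IHn; left.
  by move=> p Pp; apply: (QR (rk p) (QL _)); right.
(* As [E n] lies in [U n], a set [V] meeting finitely many [U n] meets finitely many of the finite
   sets [E n]. *)
- move=> x; have [V xV V_finite] := U_lf x; exists V => //.
  apply: (@sub_finite_set _ _
    (Q 0%N `|` \bigcup_(n in [set n | V `&` U n !=set0]) E n)).
    move=> y [Vy [Qy|[n _ Ey]]]; [by left|right].
    by exists n => //; exists y; split => //; exact: EU.
  rewrite finite_setU; split; first by have [] := Qh 0%N.
  apply: bigcup_finite => // n _; exact: finite_image.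
Qed.

End paratopological.

(** An infinite locally finite collection contains an injective sequence. Injectivity turns finitely
    many members meeting [V] into finitely many indices. *)
Lemma not_feebly_compact_sequence (T : topologicalType) : ~ feebly_compact T ->
  exists U : nat -> set T, (forall n, open (U n) /\ U n !=set0) /\
    (forall x : T, exists2 V, nbhs x V & finite_set [set n | V `&` U n !=set0]).
Proof.
move=> /existsNP[F /not_implyP[F_open /not_implyP[F_lf /infiniteP]]].
move=> /pcard_leP[f].
have fF n : F (f n) by exact: funS.
exists f; split => [n|x]; first exact: F_open.
have [V xV V_finite] := F_lf x; exists V => //.
apply: sub_finite_set (finite_preimage _ V_finite).
  by move=> n [y [Vy fy]]; split => //; exists y.
by move=> m n _ _; apply: (@inj _ _ _ f); rewrite inE.
Qed.

Theorem proposition4p4 (G : paratopologicalGroupType) (P : set G)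
    (G_nfc : ~ feebly_compact G)
    (G_precompact : precompact_group G)
    (G_T1 : accessible_space G)
    (P_subgroup : is_subgroup P)
    (P_countable : countable P)
    (P_dense : dense P) :
  (exists L : set G,
     [/\ L `<=` P, discrete_subspace L, closed L, generated_subgroup L = P
       & suitable_set L]) /\
  (exists S : set G, closed_suitable_set S).
Proof.
have [U [U_open U_lf]] := not_feebly_compact_sequence G_nfc.
have [L [LP genL L_lf]] := locally_finite_generators G_precompact P_subgroup
  P_countable P_dense U_open U_lf.
have L_closed : closed L by exact: locally_finite_closed.
have L_discrete : discrete_subspace L by exact: locally_finite_discrete.
have L_suitable : suitable_set L.
  split; [by []| |by rewrite genL].
  by apply: closedU => //; exact: accessible_closed_set1.
by split; exists L.
Qed.
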